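(* Let $d\geq 1$ and let $S_{\boldsymbol{A}}:\ell(\mathbb{Z})^2\to\ell(\mathbb{Z})^2$ be a subdivision operator with mask $\boldsymbol{A}\in\ell(\mathbb{Z})^{2\times 2}_0$ satisfying the spectral condition of order $d$. Let $S_{\boldsymbol{B}^{[d]}}$ be a subdivision operator such that $$\mathscr{G}^{[d]}S_{\boldsymbol{A}}=2^{-d}S_{\boldsymbol{B}^{[d]}}\mathscr{G}^{[d]},$$ where $\mathscr{G}^{[d]}$ is the $d$-th Gregory operator. If $S_{\boldsymbol{B}^{[d]}}$ is contractive, then the Hermite subdivision scheme associated with $S_{\boldsymbol{A}}$ is $C^d$-convergent.
   Context: $\ell(\mathbb{Z})^2$ is the space of all $\mathbb{R}^2$-valued sequences $\mathbf{c}=(\mathbf{c}_j:j\in\mathbb{Z})$; $\ell(\mathbb{Z})^2_\infty$ is the subspace of those with $\|\mathbf{c}\|_\infty=\sup_j|\mathbf{c}_j|_\infty<\infty$, where $|\cdot|_\infty$ is the infinity-norm on $\mathbb{R}^2$; $\ell(\mathbb{Z})^{2\times2}_0$ is the space of finitely supported sequences of real $2\times2$ matrices indexed by $\mathbb{Z}$. The subdivision operator with mask $\boldsymbol{A}\in\ell(\mathbb{Z})^{2\times2}_0$ is $S_{\boldsymbol{A}}:\ell(\mathbb{Z})^2\to\ell(\mathbb{Z})^2$, $(S_{\boldsymbol{A}}\mathbf{c})_j=\sum_{k\in\mathbb{Z}}\boldsymbol{A}_{j-2k}\mathbf{c}_k$. Its norm is $\|S_{\boldsymbol{A}}\|_\infty=\sup\{\|S_{\boldsymbol{A}}\mathbf{c}\|_\infty:\|\mathbf{c}\|_\infty=1\}$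 (norms of powers of $S_{\boldsymbol{A}}$ are defined in the same way). $S_{\boldsymbol{B}}$ is called contractive if $\|(S_{\boldsymbol{B}})^N\|_\infty<1$ for some $N\ge1$. A function $f$ on $\mathbb{R}$ is identified with the sequence $(f(j):j\in\mathbb{Z})$ when an operator on sequences is applied to it. $D$ denotes differentiation, $Df=f'$. $\Pi_k$ is the set of real polynomials of degree $\le k$, and $\pi[j]$ denotes the coefficient of $x^j$ in $\pi$. Spectral condition of order $d$ ($d\ge1$): there exist polynomials $\mathscr{P}_k\in\Pi_k$ with $\mathscr{P}_k[k]=1/k!$ such that $S_{\boldsymbol{A}}\begin{bmatrix}\mathscr{P}_k\\ D\mathscr{P}_k\end{bmatrix}=2^{-k}\begin{bmatrix}\mathscr{P}_k\\ D\mathscr{P}_k\end{bmatrix}$ for $k=0,\ldots,d$. Forward difference: $(\Delta c)_j=c_{j+1}-c_j$; $\Delta^0=\mathrm{id}$, $\Delta^n=\Delta(\Delta^{n-1})$. Gregory coefficients: $G_n=\frac{1}{n!}\sum_{j=0}^n\genfrac{[}{]}{0pt}{}{n}{j}\frac{(-1)^{n-j}}{j+1}$, where the Stirling numbers of the first kind are given by $\genfrac{[}{]}{0pt}{}{0}{0}=1$, $\genfrac{[}{]}{0pt}{}{n}{0}=\genfrac{[}{]}{0pt}{}{0}{n}=0$ for $n\ge1$, and $\genfrac{[}{]}{0pt}{}{n+1}{m}=n\genfrac{[}{]}{0pt}{}{n}{m}+\genfrac{[}{]}{0pt}{}{n}{m-1}$ for $m\ge1$. The $n$-th Gregory operator ($n\ge1$)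 is $\mathscr{G}^{[n]}=\begin{bmatrix}0&\Delta^n\\ \Delta&-\sum_{\ell=0}^{n-1}G_\ell\Delta^\ell\end{bmatrix}$ acting on $\ell(\mathbb{Z})^2$. The Hermite subdivision scheme associated with $S_{\boldsymbol{A}}$ is the iteration $\boldsymbol{D}^{n+1}\mathbf{c}^{[n+1]}=S_{\boldsymbol{A}}\boldsymbol{D}^n\mathbf{c}^{[n]}$, $n=0,1,2,\dots$, from initial data $\mathbf{c}^{[0]}\in\ell(\mathbb{Z})^2$, where $\boldsymbol{D}=\mathrm{diag}(1,1/2)$. It is $C^d$-convergent ($d\ge1$) if for every input data $\mathbf{c}^{[0]}\in\ell(\mathbb{Z})^2_\infty$ and any compact $K\subset\mathbb{R}$ there exists $\varphi\in C^d(\mathbb{R})$ such that $\Phi=[\varphi,\varphi']^T$ and the sequence $\mathbf{c}^{[n]}$ satisfy $\lim_{n\to\infty}\sup_{j\in\mathbb{Z}\cap 2^nK}|\mathbf{c}^{[n]}_j-\Phi(2^{-n}j)|_\infty=0$; furthermore there must be at least one $\mathbf{c}^{[0]}\in\ell(\mathbb{Z})^2_\infty$ such that $\varphi\neq0$. *)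

(* Defs.v *)
From mathcomp Require Import all_boot all_order all_algebra.
From mathcomp Require Import all_classical all_reals all_analysis.

Set Implicit Arguments.
Unset Strict Implicit.
Unset Printing Implicit Defensive.

Import Order.TTheory GRing.Theory Num.Theory.
Import numFieldNormedType.Exports.
Local Open Scope classical_set_scope.
Local Open Scope ring_scope.

Section Sequences.
Context {R : realType}.

Definition vec2 (x y : R) : 'cV[R]_2 := \col_(i < 2) [:: x; y]`_i.

(* The norm of 'cV[R]_2 is the infinity-norm max(|x|, |y|). *)
Definition seq_norm (c : int -> 'cV[R]_2) : \bar R :=
  ereal_sup [set `|c j|%:E | j in [set: int]].

Definition seq_bounded (c : int -> 'cV[R]_2) : Prop := (seq_norm c < +oo)%E.

Definition op_norm (S : (int -> 'cV[R]_2) -> (int -> 'cV[R]_2)) : \bar R :=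
  ereal_sup [set seq_norm (S c) | c in [set c | seq_norm c = 1%E]].

Definition finite_mask (A : int -> 'M[R]_2) : Prop :=
  finite_set [set j | A j != 0].

(* The sum over Z is the one of fsbigop, over the support of the summand; it is
   meant for masks satisfying finite_mask, for which that support is finite. *)
Definition subdiv (A : int -> 'M[R]_2) (c : int -> 'cV[R]_2) :
    int -> 'cV[R]_2 :=
  fun j => \sum_(k \in [set: int]) A (j - 2 * k) *m c k.

Definition contractive (S : (int -> 'cV[R]_2) -> (int -> 'cV[R]_2)) : Prop :=
  exists2 N : nat, (1 <= N)%N & (op_norm (iter N S) < 1)%E.

Definition poly_seq (p : {poly R}) : int -> 'cV[R]_2 :=
  fun j => vec2 p.[j%:~R] (deriv p).[j%:~R].

Definition spectral_condition (A : int -> 'M[R]_2) (d : nat) : Prop :=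
  exists P : nat -> {poly R}, forall k : nat, (k <= d)%N ->
    [/\ (size (P k) <= k.+1)%N,
        (P k)`_k = (k`!%:R)^-1 &
        forall j : int,
          subdiv A (poly_seq (P k)) j = (2 ^+ k)^-1 *: poly_seq (P k) j].

End Sequences.

(* Unsigned Stirling numbers of the first kind. *)
Fixpoint stirling1 (n m : nat) : nat :=
  match n, m with
  | 0, 0 => 1
  | 0, _.+1 => 0
  | _.+1, 0 => 0
  | n'.+1, m'.+1 => n' * stirling1 n' m + stirling1 n' m'
  end.

Section Gregory.
Context {R : realType}.

Definition fdiff (u : int -> R) : int -> R := fun j => u (j + 1) - u j.

Definition gregory_coef (n : nat) : R :=
  (n`!%:R)^-1 *
  \sum_(j < n.+1) (stirling1 n j)%:R * ((-1) ^+ (n - j) / j.+1%:R).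

Definition gregory_op (n : nat) (c : int -> 'cV[R]_2) : int -> 'cV[R]_2 :=
  let c1 : int -> R := fun j => c j 0 0 in
  let c2 : int -> R := fun j => c j 1 0 in
  fun j => vec2 (iter n fdiff c2 j)
                (fdiff c1 j - \sum_(l < n) gregory_coef l * iter l fdiff c2 j).

End Gregory.

Section Hermite.
Context {R : realType}.

Definition dil : 'M[R]_2 := diag_mx (\row_(i < 2) [:: 1; 2^-1]`_i).

(* Since dil is invertible, c is determined by its initial data c 0. *)
Definition hermite_scheme (A : int -> 'M[R]_2)
    (c : nat -> int -> 'cV[R]_2) : Prop :=
  forall (n : nat) (j : int),
    dil ^+ n.+1 *m c n.+1 j = subdiv A (fun k => dil ^+ n *m c n k) j.

Definition class_C (d : nat) (f : R -> R) : Prop :=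
  (forall (k : nat) (x : R), (k < d)%N -> derivable (derive1n k f) x 1) /\
  continuous (derive1n d f).

Definition hermite_fun (f : R -> R) : R -> 'cV[R]_2 :=
  fun x => vec2 (f x) (derive1 f x).

(* For compact K the index set is finite, so that the supremum is a genuine one;
   it is 0 when the index set is empty. *)
Definition limit_on (c : nat -> int -> 'cV[R]_2) (K : set R)
    (f : R -> R) : Prop :=
  sup [set `|c n j - hermite_fun f ((2 ^+ n)^-1 * j%:~R)|
      | j in [set j : int | [set 2 ^+ n * x | x in K] j%:~R]]
    @[n --> \oo] --> (0 : R).

(* On a single compact set the limit function is not determined (K may contain
   no dyadic point). In the nontriviality clause it is therefore one function
   that is the limit on every compact set, hence the unique such function. *)
Definition hermite_convergent (A : int -> 'M[R]_2) (d : nat) : Prop :=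
  (forall c : nat -> int -> 'cV[R]_2,
     hermite_scheme A c -> seq_bounded (c 0%N) ->
     forall K : set R, compact K ->
     exists f : R -> R, class_C d f /\ limit_on c K f) /\
  (exists c : nat -> int -> 'cV[R]_2,
     [/\ hermite_scheme A c, seq_bounded (c 0%N) &
         exists f : R -> R,
           [/\ class_C d f,
               (forall K : set R, compact K -> limit_on c K f) &
               exists x : R, f x != 0]]).

End Hermite.

(* Main.v *)
(* Write [s n] for the data [S_A^n c] and [level m] for the first component
   ([m = 0]) or the [(m-1)]-st difference of the second one. The factorization
   through the contractive [S_B] gives [G s_n = O(r^n 2^(-dn))] with [r < 1],
   where [G] is the Gregory operator of order [d]. On the spectral polynomials
   [G] vanishes, again because [S_B] is contractive, so that no property of the
   Gregory coefficients except [G_0 = 1] is needed. Subtracting a polynomial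
   interpolant, on which [S_A] acts by [P_k |-> 2^(-k) P_k], one bounds
   [level m (S_A c)(2j+e) - 2^(-m) level m c j], for [e = 0, 1], by the Gregory
   operator of order [m] applied to [c]. By descending induction on [m] the
   scaled levels [2^(mn) level m (s n)] are therefore uniformly Cauchy at
   geometric rate along the dyadic points, and each limit is the derivative of
   the previous one because its difference quotients are the next level. *)

Require Import Defs.
From mathcomp Require Import all_boot all_order all_algebra.
From mathcomp Require Import all_classical all_reals all_analysis.
From mathcomp Require Import zify ring lra.

Set Implicit Arguments.
Unset Strict Implicit.
Unset Printing Implicit Defensive.

Import Order.TTheory GRing.Theory Num.Theory.
Import numFieldNormedType.Exports.
Local Open Scope classical_set_scope.
Local Open Scope ring_scope.

(** * Subdivision operators *)

Section Subdivision.
Context {R : realType}.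
Implicit Types (A : int -> 'M[R]_2) (c g : int -> 'cV[R]_2) (v w : 'cV[R]_2).

Lemma vec2E0 (x y : R) : vec2 x y 0 0 = x.
Proof. by rewrite mxE. Qed.

Lemma vec2E1 (x y : R) : vec2 x y 1 0 = y.
Proof. by rewrite mxE. Qed.

Lemma ord2P (P : 'I_2 -> Prop) : P 0 -> P 1 -> forall i, P i.
Proof.
move=> P0 P1 [[|[|//]] ilt]; [have -> : Ordinal ilt = 0|have -> : Ordinal ilt = 1] => //; exact: val_inj.
Qed.

Lemma eq_vec2 v w : v 0 0 = w 0 0 -> v 1 0 = w 1 0 -> v = w.
Proof. by move=> e0 e1; apply/matrixP => i j; rewrite (ord1 j); elim/ord2P: i. Qed.

Lemma vec_norm_le v (x : R) : 0 <= x ->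
  (forall i, `|v i 0| <= x) -> `|v| <= x.
Proof.
move=> x0 vx; have [->|v0] := eqVneq v 0; first by rewrite normr0.
have : mx_norm v != 0 by apply: contra_neq v0; exact: mx_norm_eq0.
by case/mx_norm_neq0 => -[i j] /= e; rewrite [leLHS]e (ord1 j).
Qed.

Lemma entry_le_norm v i : `|v i 0| <= `|v|.
Proof.
rewrite [leRHS]mx_normrE.
exact: (le_bigmax _ (fun ij : 'I_2 * 'I_1 => `|v ij.1 ij.2|) (i, 0)).
Qed.

Lemma finite_mask_bounded A : finite_mask A ->
  exists M : nat, forall j : int, (M < `|j|)%N -> A j = 0.
Proof.
move=> /finite_seqP[s sE]; exists (\max_(j <- s) `|j|)%N => j jM.
apply/eqP/negPn/negP => Aj; have : [set j | A j != 0] j by [].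
rewrite sE /= => js; move: jM; rewrite ltnNge => /negP; apply.
exact: (@leq_bigmax_seq _ s xpredT (fun j : int => `|j|%N)).
Qed.

(** With [j = 2 a + e] the mask index is [e - 2 (k - a)], which exceeds [M] in absolute value once
    [|k - a| > M] and [e <= M]. All these [e] share one window around [a]. *)
Lemma subdiv_window A (M : nat) : (forall j : int, (M < `|j|)%N -> A j = 0) ->
  forall c (a : int) (e : nat), (e <= M)%N ->
  subdiv A c (2 * a + e%:Z) =
    \sum_(i < M.*2.+1) A (e%:Z - 2 * (i%:Z - M%:Z)) *m c (a + (i%:Z - M%:Z)).
Proof.
move=> AM c a e eM; pose s : seq int := [seq a + (i%:Z - M%:Z) | i <- iota 0 M.*2.+1].
have out (k : int) : k \notin s -> A (2 * a + e%:Z - 2 * k) *m c k = 0.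
  move=> ks; rewrite AM ?mul0mx// ltnNge; apply: contra ks => kM.
  apply/mapP; exists (absz (k - a + M%:Z)); last lia.
  by rewrite mem_iota; lia.
rewrite /subdiv (fsbigE s)//; last 2 first.
- by rewrite map_inj_uniq ?iota_uniq// => i j; lia.
- by move=> k _; exact: out.
rewrite big_map (eq_bigl xpredT) => [|k]; last by rewrite in_setT.
rewrite -[iota 0 _]/(index_iota 0 M.*2.+1) big_mkord; apply: eq_bigr => i _.
by congr (A _ *m _); lia.
Qed.

Lemma int_parity (j : int) :
  exists (a : int) (e : nat), (e <= 1)%N /\ j = 2 * a + e%:Z.
Proof.
exists (divz j 2), `|modz j 2|%N.
have := modz_ge0 j (isT : (2 : int) != 0).
have := ltz_pmod j (isT : 0 < (2 : int)).
by rewrite {4}(divz_eq j 2); lia.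
Qed.

Lemma finite_mask_window A (n : nat) : finite_mask A ->
  exists2 M : nat, (n <= M)%N &
    forall c (a : int) (e : nat), (e <= M)%N ->
    subdiv A c (2 * a + e%:Z) = \sum_(i < M.*2.+1)
      A (e%:Z - 2 * (i%:Z - M%:Z)) *m c (a + (i%:Z - M%:Z)).
Proof.
move=> /finite_mask_bounded[M AM]; exists (n + M)%N; first lia.
by apply: subdiv_window => j jM; apply: AM; lia.
Qed.

Lemma subdivD A c g : finite_mask A ->
  subdiv A (fun j => c j + g j) =1 (fun j => subdiv A c j + subdiv A g j).
Proof.
move=> /(finite_mask_window 1)[M M1 AM] j.
have [a [e [e1 ->]]] := int_parity j.
rewrite !AM ?(leq_trans e1)// -big_split.
by apply: eq_bigr => i _; rewrite mulmxDr.
Qed.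

Lemma subdivZ A (x : R) c : finite_mask A ->
  subdiv A (fun j => x *: c j) =1 (fun j => x *: subdiv A c j).
Proof.
move=> /(finite_mask_window 1)[M M1 AM] j.
have [a [e [e1 ->]]] := int_parity j.
rewrite !AM ?(leq_trans e1)// scaler_sumr.
by apply: eq_bigr => i _; rewrite scalemxAr.
Qed.

Lemma iter_subdivZ A (x : R) c n : finite_mask A ->
  iter n (subdiv A) (fun j => x *: c j) =1
  (fun j => x *: iter n (subdiv A) c j).
Proof.
move=> Af; elim: n => //= n IH j; rewrite -subdivZ//.
by congr subdiv; apply/funext.
Qed.

Lemma mulmx_entry_le (U : 'M[R]_2) v i (x : R) : (forall i, `|v i 0| <= x) ->
  `|(U *m v) i 0| <= (\sum_k \sum_l `|U k l|) * x.
Proof.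
move=> vx; have x0 : 0 <= x by exact: le_trans (vx 0).
rewrite mxE (le_trans (ler_norm_sum _ _ _))//.
rewrite (le_trans (y := \sum_j `|U i j| * x))//.
  by apply: ler_sum => j _; rewrite normrM ler_wpM2l.
rewrite -mulr_suml ler_wpM2r// [leRHS](bigD1 i)//= lerDl.
by apply: sumr_ge0 => k _; apply: sumr_ge0.
Qed.

(** Summing the mask entries over all [e <= n] makes [K] independent of [e], so that consecutive
    output entries share one constant. *)
Lemma subdiv_local_bound A (n : nat) : finite_mask A ->
  exists (M : nat) (K : R), [/\ (n <= M)%N, 0 <= K &
    forall c (x : R) (a : int) (e : nat), (e <= n)%N ->
      (forall k : int, (`|k - a| <= M)%N -> forall i, `|c k i 0| <= x) ->
      forall i, `|subdiv A c (2 * a + e%:Z) i 0| <= K * x].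
Proof.
move=> /(finite_mask_window n)[M nM AM]; pose H (e : 'I_n.+1) (i : nat) :=
  \sum_k \sum_l `|A (e%:Z - 2 * (i%:Z - M%:Z)) k l|.
exists M, (\sum_(e < n.+1) \sum_(i < M.*2.+1) H e i); split => //.
  by do 4 (apply: sumr_ge0 => ? _).
move=> c x a e en cx i; rewrite AM ?(leq_trans en)// summxE.
have x0 : 0 <= x.
  by apply: le_trans (cx a _ 0) => //; rewrite subrr.
have en' : (e < n.+1)%N by [].
rewrite (le_trans (ler_norm_sum _ _ _))// (bigD1 (Ordinal en'))//= mulrDl.
rewrite ler_wpDr//.
  by apply: mulr_ge0 => //; do 4 (apply: sumr_ge0 => ? _).
rewrite mulr_suml; apply: ler_sum => j _; apply: mulmx_entry_le => k.
by apply: cx; have := ltn_ord j; lia.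
Qed.

End Subdivision.

(** * Contractive subdivision operators *)

Section Decay.
Context {R : realType}.
Implicit Types (B : int -> 'M[R]_2) (g : int -> 'cV[R]_2).

Lemma norm_le_seq_norm g j : (`|g j|%:E <= seq_norm g)%E.
Proof. by apply: ereal_sup_ubound; exists j. Qed.

Lemma seq_norm_le g (x : R) : (forall j, `|g j| <= x) -> (seq_norm g <= x%:E)%E.
Proof. by move=> gx; apply/ereal_supP => _ [j _ <-]; rewrite lee_fin. Qed.

Lemma seq_norm_fin g (x : R) : (forall j, `|g j| <= x) ->
  exists s : R, [/\ seq_norm g = s%:E, 0 <= s, s <= x & forall j, `|g j| <= s].
Proof.
move=> gx; have := seq_norm_le gx; have := norm_le_seq_norm g.
case: (seq_norm g) => [s| |] gs sx //; last by have := gs 0.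
exists s; split => //; by have := gs 0; rewrite lee_fin; apply: le_trans.
Qed.

(** Normalizing [g] turns the supremum over the unit sphere in [op_norm] into a homogeneous bound
    with a real factor. *)
Lemma contractive_bound B : finite_mask B -> contractive (subdiv B) ->
  exists (N : nat) (theta : R), [/\ (0 < N)%N, 0 <= theta, theta < 1 &
    forall g (x : R), (forall j, `|g j| <= x) ->
      forall j, `|iter N (subdiv B) g j| <= theta * x].
Proof.
move=> Bf [N N1 SN].
have [theta [theta0 theta1 Stheta]] : exists theta : R, [/\ 0 <= theta,
    theta < 1 & forall g, seq_norm g = 1%E ->
      forall j, `|iter N (subdiv B) g j| <= theta].
  have SNg g j : seq_norm g = 1%E ->
      (`|iter N (subdiv B) g j|%:E <= op_norm (iter N (subdiv B)))%E.
    move=> g1; apply: le_trans (norm_le_seq_norm _ j) _.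
    by apply: ereal_sup_ubound; exists g.
  move: SN SNg; case: (op_norm _) => [t| |] // t1 SNg.
    exists (Num.max t 0); split => [||g g1 j].
    - by rewrite le_max lexx orbT.
    - by rewrite gt_max -lte_fin t1 ltr01.
    - by rewrite le_max -lee_fin SNg.
  (* If the supremum were [-oo], no sequence would have norm 1, and any factor would serve. *)
  by exists 0; split => // g g1 j; have := SNg g j g1.
exists N, theta; split => // g x gx j.
have [s [gsE s0 sx gs]] := seq_norm_fin gx.
rewrite (le_trans (y := theta * s)) ?ler_wpM2l//.
have [s00|sN0] := eqVneq s 0.
  have -> : g = (fun k => 0 *: g k).
    apply/funext => k; rewrite scale0r; apply/eqP.
    by rewrite -normr_le0 (le_trans (gs k)) ?s00.
  by rewrite iter_subdivZ// scale0r normr0 mulr_ge0.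
have s_gt0 : 0 < s by rewrite lt_def sN0.
pose h k := s^-1 *: g k.
have hg k : `|g k| = s * `|h k|.
  by rewrite /h normrZ ger0_norm ?invr_ge0// mulVKf.
have h1 k : `|h k| <= 1 by rewrite -(ler_pM2l s_gt0) -hg mulr1.
have [t [ht t0 t1 hkt]] := seq_norm_fin h1.
(* So far [t <= 1]; conversely [s] is the least bound of [g], and [s * t] is a bound too. *)
suff h1' : 1 <= t.
  have {}h1' : seq_norm h = 1%E by rewrite ht; congr (_%:E); apply/le_anti/andP.
  have -> : g = fun k => s *: h k.
    by apply/funext => k; rewrite /h scalerA divff// scale1r.
  by rewrite iter_subdivZ// normrZ ger0_norm// mulrC ler_wpM2r// Stheta.
rewrite -(ler_pM2l s_gt0) mulr1 -lee_fin; rewrite -gsE.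
by apply: seq_norm_le => k; rewrite hg ler_pM2l.
Qed.

Lemma subdiv_bounded B : finite_mask B -> exists2 K : R, 0 <= K &
  forall g (x : R), (forall j, `|g j| <= x) ->
    forall j, `|subdiv B g j| <= K * x.
Proof.
move=> /(subdiv_local_bound 1)[M [K [_ K0 BK]]]; exists K => // g x gx j.
have x0 : 0 <= x by exact: le_trans (gx 0).
have [a [e [e1 ->]]] := int_parity j.
apply: vec_norm_le => [|i]; first exact: mulr_ge0.
by apply: BK => // k _ l; apply: le_trans (entry_le_norm _ _) (gx k).
Qed.

Lemma iter_subdiv_bounded B (g : int -> 'cV[R]_2) (x : R) n : finite_mask B ->
  (forall j, `|g j| <= x) ->
  exists2 y : R, 0 <= y & forall j, `|iter n (subdiv B) g j| <= y.
Proof.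
move=> /subdiv_bounded[K K0 BK] gx; have x0 : 0 <= x by exact: le_trans (gx 0).
elim: n => [|n [y y0 IH]]; first by exists x.
by exists (K * y) => [|j]; [exact: mulr_ge0|exact: BK].
Qed.

(** A substitute for the [N]-th root of [theta]: Bernoulli's inequality gives
    [(1 - t) ^ N >= 1 - N t >= theta]. The denominator [N + 2] of [t] keeps [r >= 1/2], so that a
    factor [2 ^ (-n)] can later be absorbed into [r ^ n]. *)
Lemma bernoulli_root (theta : R) (N : nat) : 0 <= theta -> theta < 1 ->
  exists r : R, [/\ 2^-1 <= r, r < 1 & theta <= r ^+ N].
Proof.
move=> theta0 theta1; pose t : R := (1 - theta) / N.+2%:R.
have N2 : 0 < N.+2%:R :> R by [].
have t_gt0 : 0 < t by apply: divr_gt0 => //; lra.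
have t_half : t <= 2^-1.
  rewrite /t ler_pdivrMr//; apply: (@le_trans _ _ 1); first lra.
  by rewrite -[N.+2]addn2 natrD; have N_ge0 := ler0n R N; lra.
exists (1 - t); split; [lra|lra|].
have bernoulli n : 1 - n%:R * t <= (1 - t) ^+ n.
  elim: n => [|n IH]; first by rewrite mul0r subr0.
  rewrite exprS -[n.+1]addn1 natrD.
  have : (1 - t) * (1 - n%:R * t) <= (1 - t) * (1 - t) ^+ n.
    by rewrite ler_wpM2l//; lra.
  have ? : 0 <= n%:R * (t * t) by apply: mulr_ge0 => //; apply: mulr_ge0; exact: ltW.
  by lra.
apply: le_trans (bernoulli N).
suff : N%:R * t <= 1 - theta by lra.
rewrite /t mulrCA ger_pMr ?subr_gt0// ler_pdivrMr// mul1r ler_nat; lia.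
Qed.

(** Every block of [N] steps gains a factor [theta <= r ^ N], and [C] covers the first [N] iterates.
    The rate [r] depends on [B] only, [C] also on the data. *)
Lemma contractive_decay B : finite_mask B -> contractive (subdiv B) ->
  exists r : R, [/\ 2^-1 <= r, r < 1 &
    forall g (x : R), (forall j, `|g j| <= x) ->
      exists2 C : R, 0 <= C &
        forall n j, `|iter n (subdiv B) g j| <= C * r ^+ n].
Proof.
move=> Bf /(contractive_bound Bf)[N [theta [N0 theta0 theta1 Btheta]]].
have [r [r_half r1 thetar]] := bernoulli_root N theta0 theta1.
have r0 : 0 < r by lra.
exists r; split => // g x gx.
have [y_ y0 gy] : exists2 y_ : nat -> R, (forall n, 0 <= y_ n) &
    forall n j, `|iter n (subdiv B) g j| <= y_ n.
  have /choice[y_ yP] n : exists y : R,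
      0 <= y /\ forall j, `|iter n (subdiv B) g j| <= y.
    by have [y] := iter_subdiv_bounded n Bf gx; exists y.
  by exists y_ => n; have [] := yP n.
have yr0 n : 0 <= y_ n / r ^+ n by rewrite divr_ge0// exprn_ge0// ltW.
exists (\sum_(n < N) y_ n / r ^+ n) => [|n]; first exact: sumr_ge0.
have [m] := ubnP n; elim: m n => // m IH n nm j.
have [nN|Nn] := ltnP n N.
  apply: le_trans (gy n j) _; rewrite -ler_pdivrMr ?exprn_gt0//.
  by rewrite (bigD1 (Ordinal nN))//= lerDl sumr_ge0.
rewrite -(subnKC Nn) iterD exprD.
have IHn k := IH (n - N)%N ltac:(lia) k.
apply: le_trans (Btheta _ _ IHn j) _.
rewrite mulrCA ler_wpM2l ?sumr_ge0// ler_wpM2r ?exprn_ge0//; exact: ltW.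
Qed.

End Decay.

(** * Differences of Hermite data *)

Section Levels.
Context {R : realType}.
Implicit Types (c g : int -> 'cV[R]_2) (u : int -> R) (P : {poly R}).

(* The [m]-th level is, up to the factor [2 ^ (m n)] at step [n], the divided
   difference that converges to the [m]-th derivative of the limit. *)
Definition level (m : nat) c : int -> R :=
  if m is i.+1 then iter i fdiff (fun j => c j 1 0) else fun j => c j 0 0.

(** The second component of [gregory_op m], isolated because the induction varies the order. The
    Gregory coefficients are the integrals of the binomial polynomials over [0,1], so this is the
    remainder of Gregory's quadrature formula, which expands [f(j+1) - f(j)] in differences of
    [f']. *)
Definition defect (m : nat) c : int -> R :=
  fun j => fdiff (level 0 c) j - \sum_(i < m) gregory_coef i * level i.+1 c j.

Lemma gregory_opE n c j : gregory_op n c j = vec2 (level n.+1 c j) (defect n c j).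
Proof. by []. Qed.

Lemma fdiff_comb u v (a : R) j :
  fdiff (fun k => u k + a * v k) j = fdiff u j + a * fdiff v j.
Proof. by rewrite /fdiff; ring. Qed.

Lemma iter_fdiff_comb n u v (a : R) j :
  iter n fdiff (fun k => u k + a * v k) j =
    iter n fdiff u j + a * iter n fdiff v j.
Proof.
elim: n j => //= n IH j; rewrite -fdiff_comb.
by congr fdiff; apply/funext.
Qed.

Lemma level_comb m c g (a : R) j :
  level m (fun k => c k + a *: g k) j = level m c j + a * level m g j.
Proof.
case: m => [|m] /=; first by rewrite !mxE.
rewrite -iter_fdiff_comb; congr (iter m fdiff _ _).
by apply/funext => k; rewrite !mxE.
Qed.

Lemma defect_comb m c g (a : R) j :
  defect m (fun k => c k + a *: g k) j = defect m c j + a * defect m g j.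
Proof.
rewrite /defect /fdiff !level_comb mulrBr mulr_sumr.
under eq_bigr do rewrite level_comb mulrDr mulrCA.
by rewrite big_split /=; ring.
Qed.

Lemma level0 m j : level m (fun=> 0) j = 0.
Proof.
case: m => [|m] /=; first by rewrite mxE.
by elim: m j => [|m IH] j /=; [rewrite mxE|rewrite /fdiff !IH subrr].
Qed.

Lemma levelZ m c (a : R) j : level m (fun k => a *: c k) j = a * level m c j.
Proof.
rewrite -[RHS]add0r -[in RHS](level0 m j) -level_comb; congr (level m _ _).
by apply/funext => k; rewrite add0r.
Qed.

Lemma defectZ m c (a : R) j :
  defect m (fun k => a *: c k) j = a * defect m c j.
Proof.
rewrite /defect /fdiff !levelZ mulrBr mulr_sumr mulrBr; congr (_ - _).
by apply: eq_bigr => i _; rewrite levelZ mulrCA.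
Qed.

Lemma level_shift m c (a j : int) :
  level m (fun k => c (a + k)) j = level m c (a + j).
Proof.
case: m => [//|m] /=; elim: m j => //= m IH j.
by rewrite {1}/fdiff !IH /fdiff addrA.
Qed.

Lemma defect_shift m c (a j : int) :
  defect m (fun k => c (a + k)) j = defect m c (a + j).
Proof.
rewrite /defect /fdiff !level_shift addrA; congr (_ - _).
by apply: eq_bigr => i _; rewrite level_shift.
Qed.

(** [level m] at [a] reads no entry beyond [a + m], and each difference at most doubles the
    bound. *)
Lemma level_le m c (x : R) (a : int) :
  (forall k : nat, (k <= m)%N -> forall i, `|c (a + k%:Z) i 0| <= x) ->
  `|level m c a| <= 2 ^+ m * x.
Proof.
move=> cx; have x0 : 0 <= x by exact: le_trans (cx 0%N _ 0).
case: m cx => [|m] cx; first by rewrite mul1r -[a]addr0; exact: cx.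
rewrite exprS -mulrA; apply: le_trans (_ : 2 ^+ m * x <= _); last first.
  by apply: ler_peMl; [rewrite mulr_ge0 ?exprn_ge0|lra].
have {}cx (k : nat) : (k <= m)%N -> `|c (a + k%:Z) 1 0| <= x.
  by move=> km; apply: cx; exact: leqW.
rewrite /=; elim: m a cx => [|m IH] a cx /=.
  by rewrite mul1r -[a]addr0; exact: cx.
apply: le_trans (ler_normB _ _) _; rewrite exprS -mulrA [2]/(1 + 1) mulrDl !mul1r.
apply: lerD; apply: IH => k km; last by apply: cx; exact: leqW.
by rewrite -addrA -intS; exact: cx.
Qed.

Lemma fdiff_growth u (M : nat) (x : R) : u 0 = 0 ->
  (forall j : int, (`|j| <= M)%N -> `|fdiff u j| <= x) ->
  forall j : int, (`|j| <= M)%N -> `|u j| <= `|j|%N%:R * x.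
Proof.
move=> u0 ux; elim/int_ind => [|n IH|n IH] jM.
- by rewrite u0 normr0 mul0r.
- have nM : (`|n%:Z| <= M)%N by lia.
  rewrite (_ : n.+1%:Z = n%:Z + 1); last by lia.
  have -> : u (n%:Z + 1) = fdiff u n + u n by rewrite /fdiff subrK.
  rewrite (_ : `|(n%:Z + 1)%R|%N = n.+1); last lia.
  rewrite -[n.+1]add1n natrD mulrDl mul1r.
  by apply: le_trans (ler_normD _ _) _; apply: lerD; [exact: ux|exact: IH].
- have nM : (`|(- n%:Z)%R| <= M)%N by lia.
  have -> : u (- n.+1%:Z) = u (- n%:Z) - fdiff u (- n.+1%:Z).
    by rewrite /fdiff (_ : - n.+1%:Z + 1 = - n%:Z); [ring|lia].
  rewrite (_ : `|(- n.+1%:Z)%R|%N = n.+1); last lia.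
  rewrite -[n.+1]addn1 natrD mulrDl mul1r.
  apply: le_trans (ler_normB _ _) _; apply: lerD; last by apply: ux; lia.
  by move: (IH nM); rewrite (_ : `|(- n%:Z)%R|%N = n)//; lia.
Qed.

Lemma fdiff_const u : (forall j, fdiff u j = 0) -> forall j, u j = u 0.
Proof.
move=> uj j; pose v k := u k - u 0.
have : `|v j| <= `|j|%N%:R * 0.
  apply: (@fdiff_growth v `|j|%N) => [|k _|//]; first by rewrite /v subrr.
  by rewrite /fdiff /v opprB addrA subrK -/(fdiff u k) uj normr0.
by rewrite mulr0 normr_le0 subr_eq0 => /eqP.
Qed.

(** The Leibniz rule for a product with the identity. At [n = 0] the term with [n.-1] has the factor
    zero. *)
Lemma iter_fdiff_mul n u (j : int) :
  iter n fdiff (fun k => u k * k%:~R) j =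
    iter n fdiff u j * j%:~R + n%:R * iter n.-1 fdiff u (j + 1).
Proof.
elim: n j => [|n IH] j /=; first by rewrite mul0r addr0.
rewrite {1}/fdiff !IH; case: n IH => [|n] IH /=; rewrite /fdiff /=.
  by rewrite intrD; ring.
by rewrite intrD -addn1 natrD; ring.
Qed.

(** By the Leibniz rule [P * 'X + a] reduces to [P], whose coefficient at [n] vanishes and whose
    coefficient at [n - 1] gives the result. *)
Lemma iter_fdiff_poly n P (j : int) : (size P <= n.+1)%N ->
  iter n fdiff (fun k => P.[k%:~R]) j = n`!%:R * P`_n.
Proof.
elim/poly_ind: P n j => [|P a IH] n j szP.
  rewrite coef0 mulr0; under eq_fun do rewrite horner0.
  by elim: n j {szP} => //= n IH j; rewrite /fdiff !IH subrr.
have szP' : (size P <= n)%N.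
  have [->|P0] := eqVneq P 0; first by rewrite size_poly0.
  by move: szP; rewrite size_MXaddC (negbTE P0).
have -> : (fun k : int => (P * 'X + a%:P).[k%:~R]) =
    (fun k : int => P.[k%:~R] * k%:~R + a * 1).
  by apply/funext => k; rewrite !hornerE.
rewrite (iter_fdiff_comb n (fun k => P.[k%:~R] * k%:~R) (fun=> 1)).
rewrite iter_fdiff_mul IH; last exact: leqW.
rewrite (nth_default _ szP') mulr0 mul0r add0r coefD coefMX coefC.
case: n szP szP' => [|n] szP szP' /=.
  by rewrite mul0r mulr1 !add0r mul1r.
rewrite IH// addr0 factS natrM mulrA.
suff cst0 k i : iter k.+1 fdiff (fun=> 1) i = 0 :> R by rewrite -iterS cst0 mulr0 addr0.
elim: k i => [|k IHk] i; first exact: subrr.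
by rewrite iterS {1}/fdiff !IHk subrr.
Qed.

(** On polynomials of degree at most [m] this level is the [m]-th derivative: for [m >= 1] it takes
    [m - 1] differences of [P']. It kills all lower degrees. *)
Lemma level_poly m P (j : int) : (size P <= m.+1)%N ->
  level m (poly_seq P) j = m`!%:R * P`_m.
Proof.
case: m => [|m] szP /=.
  rewrite vec2E0 mul1r; move/size1_polyC: szP => ->.
  by rewrite hornerC coefC.
transitivity (iter m fdiff (fun k : int => P^`().[k%:~R]) j).
  by congr (iter m fdiff _ j); apply/funext => k; rewrite vec2E1.
rewrite iter_fdiff_poly; last first.
  apply/leq_sizeP => i mi; rewrite coef_deriv nth_default ?mul0rn//.
  by rewrite (leq_trans szP).
by rewrite coef_deriv factS natrM -mulr_natl; ring.
Qed.

Lemma poly_seq_comb P Q (a : R) :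
  poly_seq (P + a *: Q) = (fun j => poly_seq P j + a *: poly_seq Q j).
Proof.
by apply/funext => j; apply: eq_vec2;
  rewrite !mxE /= ?derivD ?derivZ !hornerE.
Qed.

Lemma poly_seq_shift P :
  poly_seq (P \Po ('X + 1%:P)) = (fun j => poly_seq P (1 + j)).
Proof.
apply/funext => j; apply: eq_vec2; rewrite !mxE /=.
  by rewrite horner_comp !hornerE intrD addrC.
by rewrite deriv_comp derivD derivX derivC addr0 mulr1 horner_comp !hornerE
  intrD addrC.
Qed.

Lemma size_poly_diff P n : (size P <= n.+1)%N ->
  (size (P \Po ('X + 1%:P) + (-1) *: P)%R <= n)%N.
Proof.
move=> szP; rewrite scaleN1r.
have szQ : size (P \Po ('X + 1%:P)) = size P.
  by apply: size_comp_poly2; rewrite size_XaddC.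
have [->|P0] := eqVneq P 0; first by rewrite comp_poly0 subrr size_poly0.
apply/leq_sizeP => i ni; rewrite coefB.
have [Pi|iP] := leqP (size P) i.
  by rewrite !nth_default ?szQ// subrr.
have -> : i = (size P).-1 by lia.
rewrite -{1}szQ -!lead_coefE lead_coef_comp ?size_XaddC//.
by rewrite lead_coefXaddC expr1n mulr1 subrr.
Qed.

End Levels.

(** * Gregory operators and spectral polynomials *)

Section Reproduction.
Context {R : realType}.
Implicit Types (A B : int -> 'M[R]_2) (c g e : int -> 'cV[R]_2) (P : {poly R}).

Lemma subdiv_shift A c (a j : int) : finite_mask A ->
  subdiv A c (2 * a + j) = subdiv A (fun k => c (a + k)) j.
Proof.
move=> /(finite_mask_window 1)[M M1 AM].
have [b [e [e1 ->]]] := int_parity j.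
rewrite addrA -mulrDr !AM ?(leq_trans e1)//.
by apply: eq_bigr => i _; rewrite -!addrA.
Qed.

Lemma iter_subdiv_eigen B c (x : R) n : finite_mask B ->
  subdiv B c = (fun j => x *: c j) ->
  iter n (subdiv B) c = (fun j => x ^+ n *: c j).
Proof.
move=> Bf Bc; elim: n => [|n IH]; apply/funext => j.
  by rewrite expr0 scale1r.
by rewrite iterS IH subdivZ// Bc scalerA exprSr.
Qed.

(* Differencing lowers the degree, so that by induction the second component of
   [gregory_op d] on [Pi_k] is a constant [t]; then [(0, t)] is a bounded
   eigensequence of the contractive [subdiv B] with eigenvalue [2^(d-k)], hence
   [t = 0]. *)
Lemma gregory_annihilates A B d : finite_mask A -> finite_mask B ->
  spectral_condition A d ->
  (forall c j, gregory_op d (subdiv A c) j =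
     (2 ^+ d)^-1 *: subdiv B (gregory_op d c) j) ->
  contractive (subdiv B) ->
  forall P, (size P <= d.+1)%N -> forall j, defect d (poly_seq P) j = 0.
Proof.
move=> Af Bf [p pP] AB /(contractive_bound Bf)[N [theta [N0 theta0 theta1 Btheta]]].
suff H k : (k <= d.+1)%N -> forall P, (size P <= k)%N ->
    forall j, defect d (poly_seq P) j = 0 by exact: H.
elim: k => [_ P|k IH kd P szP j].
  rewrite leqn0 size_poly_eq0 => /eqP -> j.
  have -> : poly_seq 0 = (fun=> 0) :> (int -> 'cV[R]_2).
    by apply/funext => i; apply: eq_vec2; rewrite !mxE /= ?deriv0 horner0.
  by rewrite /defect /fdiff !level0 subrr big1 ?subr0// => i _; rewrite level0 mulr0.
have {}kd : (k <= d)%N by [].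
have {}IH := IH (leqW kd); have [szp pk Ap] := pP _ kd.
(* Subtracting a multiple of [p k] cancels the coefficient of degree [k]; the rest falls under the
   induction hypothesis. *)
suff pk0 i : defect d (poly_seq (p k)) i = 0.
  pose a := P`_k * k`!%:R.
  have -> : P = (P + (- a) *: p k) + a *: p k by rewrite scaleNr subrK.
  rewrite poly_seq_comb defect_comb pk0 mulr0 addr0 IH//.
  apply/leq_sizeP => l kl; rewrite coefD coefZ.
  move: kl; rewrite leq_eqVlt => /predU1P[<-|kl].
    rewrite pk /a mulNr mulfK ?subrr// pnatr_eq0 -lt0n fact_gt0 //.
  by rewrite !nth_default ?mulr0 ?addr0// ?(leq_trans szp) ?(leq_trans szP).
(* The defect commutes with translation, and the difference of [p k] has smaller degree. *)
have cst l : defect d (poly_seq (p k)) l = defect d (poly_seq (p k)) 0.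
  apply: fdiff_const => {}l; have <- := IH _ (size_poly_diff szp) l.
  rewrite poly_seq_comb poly_seq_shift defect_comb defect_shift.
  by rewrite /fdiff mulN1r addrC [1 + l]addrC addrC.
rewrite cst {i}; set t := defect _ _ 0 in cst *.
pose mu : R := 2 ^+ d / 2 ^+ k.
have mu1 : 1 <= mu.
  by rewrite /mu ler_pdivlMr ?exprn_gt0// mul1r ler_weXn2l// ler1n.
have gE l : gregory_op d (poly_seq (p k)) l = vec2 0 t.
  rewrite gregory_opE cst level_poly ?nth_default ?mulr0//.
  - exact: leq_trans szp _.
  - exact: leq_trans szp (leqW _).
have Bg : subdiv B (gregory_op d (poly_seq (p k))) =
    (fun l => mu *: gregory_op d (poly_seq (p k)) l).
  apply/funext => l; have := AB (poly_seq (p k)) l.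
  have -> : subdiv A (poly_seq (p k)) =
      (fun l => (2 ^+ k)^-1 *: poly_seq (p k) l) by apply/funext.
  move=> /(congr1 (fun v => 2 ^+ d *: v)).
  rewrite scalerA divff ?expf_neq0 ?pnatr_eq0// scale1r => <-.
  rewrite /mu -scalerA; congr (_ *: _); apply: eq_vec2.
    by rewrite !gregory_opE levelZ !mxE.
  by rewrite !gregory_opE defectZ !mxE.
have := Btheta (gregory_op d (poly_seq (p k))) `|vec2 0 t|.
move=> /(_ (fun l => _) 0); rewrite (iter_subdiv_eigen _ Bf Bg) gE normrZ.
rewrite ger0_norm ?exprn_ge0 ?(le_trans ler01)// => /(_ _)-vt.
have {}vt : mu ^+ N * `|vec2 0 t| <= theta * `|vec2 0 t|.
  by apply: vt => l; rewrite gE.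
(* An eigenvalue [mu >= 1] contradicts the factor [theta < 1] unless the eigensequence is zero. *)
have : `|vec2 0 t| <= 0.
  have muN : 1 <= mu ^+ N by rewrite exprn_ege1.
  have := normr_ge0 (vec2 0 t); nra.
by rewrite normr_le0 => /eqP/(congr1 (fun v : 'cV_2 => v 1 0)); rewrite !mxE.
Qed.

End Reproduction.

(** * Refinement of the levels *)

Section KeyEstimate.
Context {R : realType}.
Implicit Types (A : int -> 'M[R]_2) (c e : int -> 'cV[R]_2).

(** The polynomials of [spectral_condition] become a parameter, so that several lemmas refer to the
    same choice. *)
Definition spectral_polys A d (p : nat -> {poly R}) : Prop :=
  forall k, (k <= d)%N ->
    [/\ (size (p k) <= k.+1)%N, (p k)`_k = (k`!%:R)^-1 &
        forall j,
          subdiv A (poly_seq (p k)) j = (2 ^+ k)^-1 *: poly_seq (p k) j].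

(** [e] is built from [p 0], ..., [p m]. The interpolation system is triangular with unit diagonal,
    since [level l] of [p k] is 0 for [l > k] and 1 for [l = k]. Only [p m] reaches level [m], where
    it is constant; hence the third clause relates arbitrary [i] and [j]. *)
Lemma hermite_interpolation A d (p : nat -> {poly R}) m c : finite_mask A ->
  spectral_polys A d p ->
  (forall k, (k <= d)%N -> forall j, defect d (poly_seq (p k)) j = 0) ->
  (m <= d)%N ->
  exists e : int -> 'cV[R]_2,
    [/\ forall j, level m.+1 e j = 0, forall j, defect m e j = 0,
        forall i j, level m (subdiv A e) i = (2 ^+ m)^-1 * level m e j &
        forall i, (i <= m)%N -> level i e 0 = level i c 0].
Proof.
move=> Af pP p0 md.
have lvl0 k l j : (k <= d)%N -> (k < l)%N -> level l (poly_seq (p k)) j = 0.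
  move=> kd kl; have [szp _ _] := pP _ kd.
  rewrite level_poly ?nth_default ?mulr0 ?(leq_trans szp)//; exact: leqW.
have lvl1 k j : (k <= d)%N -> level k (poly_seq (p k)) j = 1.
  move=> kd; have [szp pk _] := pP _ kd.
  by rewrite level_poly// pk mulfV// pnatr_eq0 -lt0n fact_gt0.
(* Passing from order [d] to order [m] drops only terms in levels above [m], which vanish on
   [p k]. *)
have dft k j : (k <= m)%N -> defect m (poly_seq (p k)) j = 0.
  move=> km; rewrite -(p0 k (leq_trans km md) j) /defect; congr (_ - _).
  rewrite -(subnKC md) big_split_ord /= [X in _ = _ + X]big1 ?addr0// => i _.
  by rewrite -/(level (m + i).+1 _) lvl0 ?mulr0//; lia.
(* The levels are matched from the top down: after [t] steps those above [m - t] are right, and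
   adding a multiple of [p (m - t)] leaves them unchanged. *)
suff : forall t, (t <= m.+1)%N -> exists e : int -> 'cV[R]_2,
    [/\ forall j, level m.+1 e j = 0, forall j, defect m e j = 0,
        forall i j, level m (subdiv A e) i = (2 ^+ m)^-1 * level m e j &
        forall i, (m < i + t)%N -> (i <= m)%N -> level i e 0 = level i c 0].
  move=> /(_ _ (leqnn _))[e [e1 e2 e3 e4]]; exists e; split => // i im.
  by apply: e4 => //; lia.
elim=> [_|t IH tm].
  exists (fun=> 0); split => [j|j|i j|i]; rewrite ?level0//; last by lia.
  - rewrite /defect /fdiff !level0 subrr big1 ?subr0// => i _.
    by rewrite level0 mulr0.
  - have -> : subdiv A (fun=> 0) = (fun=> 0).
      have -> : (fun=> 0) = (fun j => 0 *: c j).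
        by apply/funext => l; rewrite scale0r.
      by apply/funext => l; rewrite subdivZ// !scale0r.
    by rewrite !level0 mulr0.
have [e [e1 e2 e3 e4]] := IH (ltnW tm).
have km : (m - t <= m)%N by lia.
have kd := leq_trans km md; have [szp pk Ap] := pP _ kd.
pose a := level (m - t) c 0 - level (m - t) e 0.
exists (fun j => e j + a *: poly_seq (p (m - t)%N) j); split.
- by move=> j; rewrite level_comb e1 lvl0 ?mulr0 ?addr0.
- by move=> j; rewrite defect_comb e2 dft// mulr0 addr0.
- move=> i j; rewrite level_comb mulrDr -(e3 i j).
  have -> : subdiv A (fun j => e j + a *: poly_seq (p (m - t)%N) j) =
    (fun j => subdiv A e j +
       (a / 2 ^+ (m - t)) *: poly_seq (p (m - t)%N) j).
    by apply/funext => l; rewrite subdivD// subdivZ// Ap scalerA.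
  rewrite level_comb; congr (_ + _).
  have [->|t0] := posnP t; last by rewrite !lvl0 ?mulr0//; lia.
  by rewrite subn0 !lvl1// !mulr1 mulrC.
- move=> i it im; rewrite level_comb.
  have [->|ik] := eqVneq i (m - t)%N; first by rewrite lvl1// /a; ring.
  by rewrite lvl0 ?mulr0 ?addr0; [apply: e4; lia| |lia].
Qed.

(** Repeated summation from the origin: the levels [m], ..., [1] are each recovered from the next
    one, and level 0 from the defect and the levels [1], ..., [m]. Each summation over the window
    costs at most a factor [Q]. *)
Lemma level_vanishing_bound m (M : nat) : exists2 K : R, 0 <= K &
  forall c (x : R), 0 <= x -> (forall j, `|level m.+1 c j| <= x) ->
    (forall j, `|defect m c j| <= x) ->
    (forall i, (i <= m)%N -> level i c 0 = 0) ->
    forall j : int, (`|j| <= M)%N -> forall i, `|c j i 0| <= K * x.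
Proof.
pose Q : R := M.+1%:R.
have Q1 : 1 <= Q by rewrite ler1n.
pose G : R := \sum_(i < m) `|gregory_coef i|.
have G0 : 0 <= G by exact: sumr_ge0.
have Qm1 : 1 <= Q ^+ m by rewrite exprn_ege1.
have [Q0 Qm0 G1] : [/\ 0 <= Q, 0 <= Q ^+ m & 0 <= 1 + G] by split; lra.
exists (Q * (1 + G) * Q ^+ m) => [|c x x0 cm dm c0 j jM].
  by rewrite !mulr_ge0.
have grow u (y : R) : 0 <= y -> u 0 = 0 ->
    (forall k : int, (`|k| <= M)%N -> `|fdiff u k| <= y) ->
    forall k : int, (`|k| <= M)%N -> `|u k| <= Q * y.
  move=> y0 u0 uy k kM; apply: le_trans (fdiff_growth u0 uy kM) _.
  by rewrite ler_wpM2r// ler_nat; exact: leqW.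
have lvl t : (t <= m)%N -> forall k : int, (`|k| <= M)%N ->
    `|level (m - t).+1 c k| <= Q ^+ t * x.
  elim: t => [_ k _|t IH tm]; first by rewrite subn0 expr0 mul1r.
  rewrite exprS -mulrA; apply: grow.
  - by rewrite mulr_ge0// exprn_ge0.
  - by apply: c0; lia.
  - move=> k kM; have := IH (ltnW tm) k kM.
    by rewrite (_ : (m - t).+1 = (m - t.+1).+2)//; lia.
have lvl' i k : (i <= m)%N -> (`|k| <= M)%N -> `|level i.+1 c k| <= Q ^+ m * x.
  move=> im kM; rewrite -(subKn im); apply: le_trans (lvl _ _ k kM) _.
    exact: leq_subr.
  by rewrite ler_wpM2r// ler_weXn2l// leq_subr.
elim/ord2P.
- rewrite -!mulrA; apply: (grow (level 0 c)) => //.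
  + by rewrite !mulr_ge0.
  + exact: c0.
  + move=> k kM.
    (* The difference of level 0 is not level 1; the Gregory expansion replaces it. *)
    have -> : fdiff (level 0 c) k =
        defect m c k + \sum_(i < m) gregory_coef i * level i.+1 c k.
      by rewrite /defect subrK.
    apply: le_trans (ler_normD _ _) _; rewrite mulrDl mul1r; apply: lerD.
      by apply: le_trans (dm k) _; rewrite ler_peMl.
    apply: le_trans (ler_norm_sum _ _ _) _; rewrite mulr_suml.
    by apply: ler_sum => i _; rewrite normrM ler_wpM2l// lvl'// ltnW.
- apply: le_trans (lvl' 0%N j _ jM) _ => //; rewrite ler_wpM2r//.
  by rewrite ler_peMl// mulr_ege1// lerDl.
Qed.

(** Around [j] the data are split into a polynomial interpolant, for which level [m] scales exactly
    by [2 ^ (-m)], and a remainder. The remainder has the same [level m.+1] and [defect m] as [c]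
    and vanishing lower levels at [j], so it is of size [O(x)] on the window seen by the mask. *)
Lemma level_refinement A d (p : nat -> {poly R}) m : finite_mask A ->
  spectral_polys A d p ->
  (forall k, (k <= d)%N -> forall j, defect d (poly_seq (p k)) j = 0) ->
  (m <= d)%N ->
  exists2 K : R, 0 <= K & forall c (x : R),
    (forall j, `|level m.+1 c j| <= x) -> (forall j, `|defect m c j| <= x) ->
    forall (j : int) (e : nat), (e <= 1)%N ->
      `|level m (subdiv A c) (2 * j + e%:Z) - (2 ^+ m)^-1 * level m c j| <= K * x.
Proof.
move=> Af pP p0 md.
(* Level [m] at [2 j + e] reads entries up to [2 j + e + m], and [e + m <= m + 1]. *)
have [M [K1 [mM K10 AK]]] := subdiv_local_bound m.+1 Af.
have [K2 K20 cK] := level_vanishing_bound m M.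
exists (2 ^+ m * (K1 * K2)) => [|c x cx dx j e e1].
  by rewrite !mulr_ge0 ?exprn_ge0.
have x0 : 0 <= x by exact: le_trans (cx 0).
pose cj k := c (j + k).
have [h [h1 h2 h3 h4]] := hermite_interpolation cj Af pP p0 md.
pose g k := cj k + (-1) *: h k.
have Sg : subdiv A cj = (fun k => subdiv A g k + 1 *: subdiv A h k).
  apply/funext => k; rewrite scale1r /g subdivD// subdivZ// scaleN1r.
  by rewrite subrK.
rewrite -level_shift.
have -> : (fun k => subdiv A c (2 * j + k)) = subdiv A cj.
  by apply/funext => k; rewrite subdiv_shift.
(* The interpolant contributes exactly [2 ^ (-m)] times [level m c j], which cancels;
   [level m (subdiv A g)] remains. *)
rewrite Sg level_comb mul1r (h3 _ 0) h4// /cj level_shift addr0 addrK.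
rewrite -mulrA -[K1 * K2 * x]mulrA; apply: level_le => k km i.
rewrite -PoszD -[(e + k)%:Z]add0r -[0 in X in subdiv _ _ X](mulr0 2).
apply: AK => [|l]; first lia.
rewrite subr0 => lM; apply: cK => //.
- by move=> k'; rewrite level_comb h1 mulr0 addr0 level_shift.
- by move=> k'; rewrite defect_comb h2 mulr0 addr0 defect_shift.
- by move=> i' im; rewrite level_comb h4// mulN1r subrr.
Qed.

End KeyEstimate.

(** * Decay of the levels and defects *)

Section LevelDecay.
Context {R : realType}.
Implicit Types (A B : int -> 'M[R]_2) (c : int -> 'cV[R]_2).

Lemma refinement_bounded (u : nat -> int -> R) (x K r : R) : 0 <= K ->
  0 <= r -> r < 1 -> (forall j, `|u 0%N j| <= x) ->
  (forall n (j : int) (e : nat), (e <= 1)%N ->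
     `|u n.+1 (2 * j + e%:Z) - u n j| <= K * r ^+ n) ->
  forall n j, `|u n j| <= x + K / (1 - r).
Proof.
move=> K0 r0 r1 u0 uS n j.
have r1' : 0 < 1 - r by lra.
(* The bound by the partial geometric sum is the one that the induction reproduces. *)
apply: le_trans (_ : x + K / (1 - r) * (1 - r ^+ n) <= _); last first.
  rewrite lerD2l ler_piMr ?divr_ge0 ?(ltW r1')// lerBlDr lerDl.
  exact: exprn_ge0.
elim: n j => [|n IH] j; first by rewrite expr0 subrr mulr0 addr0.
have [a [e [e1 ->]]] := int_parity j.
rewrite -[u n.+1 _](subrK (u n a)); apply: le_trans (ler_normD _ _) _.
apply: le_trans (lerD (uS n a e e1) (IH a)) _.
rewrite [leLHS](_ : _ = x + K / (1 - r) * (1 - r ^+ n.+1))// exprS.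
by field; lra.
Qed.

Lemma gregory_bounded m c (x : R) : (forall j, `|c j| <= x) ->
  exists y : R, forall j, `|gregory_op m c j| <= y.
Proof.
move=> cx; have x0 : 0 <= x by exact: le_trans (cx 0).
have cx' j i : `|c j i 0| <= x by apply: le_trans (entry_le_norm _ _) (cx j).
have lvl l j : `|level l c j| <= 2 ^+ l * x by exact: level_le.
pose G := x + x + \sum_(i < m) `|gregory_coef i : R| * (2 ^+ i.+1 * x).
exists (2 ^+ m.+1 * x + G) => j.
have G0 : 0 <= G.
  rewrite !addr_ge0//; apply: sumr_ge0 => i _.
  by rewrite !mulr_ge0// exprn_ge0.
have x0' : 0 <= 2 ^+ m.+1 * x by rewrite mulr_ge0// exprn_ge0.
apply: vec_norm_le; first exact: addr_ge0.
rewrite gregory_opE; elim/ord2P; rewrite ?vec2E0 ?vec2E1.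
  by rewrite (le_trans (lvl _ _))// lerDl.
apply: le_trans (_ : G <= _); last by rewrite lerDr.
apply: le_trans (ler_normB _ _) _; apply: lerD.
  by apply: le_trans (ler_normB _ _) _; apply: lerD; exact: cx'.
apply: le_trans (ler_norm_sum _ _ _) _; apply: ler_sum => i _.
by rewrite normrM ler_wpM2l.
Qed.

Lemma rescale_refinement (a b K : R) m n :
  `|a - (2 ^+ m)^-1 * b| <= K / 2 ^+ (m * n) ->
  `|2 ^+ (m * n.+1) * a - 2 ^+ (m * n) * b| <= 2 ^+ m * K.
Proof.
have p0 k : 0 < 2 ^+ k :> R by rewrite exprn_gt0.
have -> : 2 ^+ (m * n.+1) * a - 2 ^+ (m * n) * b =
    2 ^+ m * ((a - (2 ^+ m)^-1 * b) * 2 ^+ (m * n)).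
  by rewrite mulnS exprD; field; rewrite expf_neq0// pnatr_eq0.
by rewrite ler_pdivlMr// !normrM !(ger0_norm (ltW (p0 _))) ler_pM2l.
Qed.

(** Descending induction on [m]. At [m = d] the factorization expresses the Gregory data of [s n] by
    [2 ^ (-dn)] and the [n]-th iterate of [subdiv B]. From [m + 1] to [m], the refinement estimate
    keeps [2 ^ ((m+1)n)] times level [m + 1] bounded. *)
Lemma level_decay A B (p : nat -> {poly R}) d (s : nat -> int -> 'cV[R]_2)
    (x : R) : finite_mask A -> finite_mask B ->
  spectral_polys A d p ->
  (forall k, (k <= d)%N -> forall j, defect d (poly_seq (p k)) j = 0) ->
  (forall c j, gregory_op d (subdiv A c) j =
     (2 ^+ d)^-1 *: subdiv B (gregory_op d c) j) ->
  contractive (subdiv B) ->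
  (forall n, s n.+1 = subdiv A (s n)) -> (forall j, `|s 0%N j| <= x) ->
  exists r : R, [/\ 2^-1 <= r, r < 1 & forall m, (m <= d)%N ->
    exists C : R, forall n j,
      `|level m.+1 (s n) j| <= C * r ^+ n / 2 ^+ (m * n) /\
      `|defect m (s n) j| <= C * r ^+ n / 2 ^+ (m * n)].
Proof.
move=> Af Bf pP p0 AB Bc sS s0.
have [r [r_half r1 Br]] := contractive_decay Bf Bc.
exists r; split => // m md; have r0 : 0 <= r by lra.
have pow_gt0 k : 0 < 2 ^+ k :> R by rewrite exprn_gt0.
have inv_ge0 k : 0 <= (2 ^+ k)^-1 :> R by rewrite invr_ge0 ltW.
rewrite -(subKn md); elim: (d - m)%N (leq_subr m d) => {m md} [_|t IH td].
  rewrite subn0; have [y gy] := gregory_bounded d s0.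
  have [C C0 BC] := Br _ _ gy; exists C => n j.
  have gn k : gregory_op d (s n) k =
      (2 ^+ (d * n))^-1 *: iter n (subdiv B) (gregory_op d (s 0%N)) k.
    elim: n k => [|n IH] k; first by rewrite muln0 invr1 scale1r.
    rewrite sS AB; have -> := funext IH.
    by rewrite subdivZ// scalerA -invfM -exprD mulnS addnC.
  have bnd i : `|gregory_op d (s n) j i 0| <= C * r ^+ n / 2 ^+ (d * n).
    apply: le_trans (entry_le_norm _ _) _.
    by rewrite gn normrZ (ger0_norm (inv_ge0 _)) mulrC ler_wpM2r.
  by have := bnd 0; have := bnd 1; rewrite gregory_opE vec2E0 vec2E1.
have [C HC] := IH (ltnW td).
set m := (d - t.+1)%N; rewrite (_ : (d - t)%N = m.+1) in HC; last by rewrite /m; lia.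
have md : (m.+1 <= d)%N by rewrite /m; lia.
have C0 : 0 <= C.
  by have [+ _] := HC 0%N 0; rewrite muln0 !expr0 divr1 mulr1; apply: le_trans.
have [K K0 AK] := level_refinement Af pP p0 md.
pose u n j := 2 ^+ (m.+1 * n) * level m.+1 (s n) j.
have uS n (j : int) (e : nat) : (e <= 1)%N ->
    `|u n.+1 (2 * j + e%:Z) - u n j| <= 2 ^+ m.+1 * (K * C) * r ^+ n.
  move=> e1; rewrite -mulrA /u sS; apply: rescale_refinement.
  have := AK (s n) _ (fun j => (HC n j).1) (fun j => (HC n j).2) j e e1.
  by rewrite !mulrA.
have s0' j : `|u 0%N j| <= 2 ^+ m.+1 * x.
  rewrite /u muln0 mul1r; apply: level_le => k _ i.
  by apply: le_trans (entry_le_norm _ _) (s0 _).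
have := refinement_bounded _ r0 r1 s0' uS.
move=> /(_ (mulr_ge0 (ltW (pow_gt0 _)) (mulr_ge0 K0 C0))); set W := _ + _ => uW.
have W0 : 0 <= W by exact: le_trans (uW 0%N 0).
(* Here [r >= 1/2] enters: the spare factor [2 ^ (-n)] is at most [r ^ n]. *)
have small n (y : R) : 0 <= y -> y / 2 ^+ (m.+1 * n) <= y * r ^+ n / 2 ^+ (m * n).
  move=> y0; rewrite -mulrA ler_wpM2l// mulSn exprD invfM.
  rewrite ler_wpM2r ?inv_ge0// -exprVn; apply: lerXn2r => //.
    by rewrite nnegrE.
have lvl n j : `|level m.+1 (s n) j| <= W * r ^+ n / 2 ^+ (m * n).
  apply: le_trans (small n _ W0); rewrite ler_pdivlMr// mulrC.
  rewrite -[X in X * _]ger0_norm ?(ltW (pow_gt0 _))// -normrM; exact: uW.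
exists (W + (C + `|gregory_coef m| * W)) => n j; split.
  apply: le_trans (lvl n j) _; rewrite ler_wpM2r ?inv_ge0//.
  rewrite ler_wpM2r ?exprn_ge0// lerDl addr_ge0// mulr_ge0//.
(* Consecutive orders of the defect differ by one term, in the level just bounded. *)
have -> : defect m (s n) j =
    defect m.+1 (s n) j + gregory_coef m * level m.+1 (s n) j.
  by rewrite /defect big_ord_recr /=; ring.
rewrite (mulrDl W) (mulrDl (W * _)) ler_wpDl//.
  by rewrite !mulr_ge0 ?invr_ge0 ?exprn_ge0.
apply: le_trans (ler_normD _ _) _; rewrite mulrDl mulrDl; apply: lerD.
  apply: le_trans (HC n j).2 _.
  apply: le_trans (small n _ _) _; first by rewrite mulr_ge0// exprn_ge0.
  rewrite ler_wpM2r ?inv_ge0// ler_piMr ?mulr_ge0 ?exprn_ge0//.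
  by rewrite exprn_ile1// ltW.
by rewrite normrM -!mulrA ler_wpM2l// mulrA.
Qed.

End LevelDecay.

(** * Limits along dyadic points *)

Section Limit.
Context {R : realType}.
Implicit Types (u z : nat -> int -> R) (f g : R -> R).

(** The intervals of radius [K r ^ n] around [v n] are nested, as [K r ^ n = C r ^ n + K r ^ (n+1)];
    the supremum of their left ends lies in all of them. *)
Lemma geometric_limit (v : nat -> R) (C r : R) : r < 1 ->
  (forall n, `|v n.+1 - v n| <= C * r ^+ n) ->
  exists l : R, forall n, `|v n - l| <= C / (1 - r) * r ^+ n.
Proof.
move=> r1 vC; have r1' : 0 < 1 - r by lra.
pose K := C / (1 - r); pose b (e : R) n := v n + e * (K * r ^+ n).
have step n : K * r ^+ n = C * r ^+ n + K * r ^+ n.+1.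
  by rewrite /K exprS; field; lra.
have [lo hi] : {homo b (-1) : n k / (n <= k)%N >-> n <= k} /\
    {homo b 1 : n k / (n <= k)%N >-> k <= n}.
  split; [apply: homo_leq => [//|? ? ?|n]|apply: homo_leq => [//|y x t xy yt|n]].
  - exact: le_trans.
  - by have := vC n; rewrite ler_norml /b (step n) => /andP[vl vr]; lra.
  - exact: le_trans yt xy.
  - by have := vC n; rewrite ler_norml /b (step n) => /andP[vl vr]; lra.
have K0 n : 0 <= K * r ^+ n.
  by rewrite /K mulrAC; apply: divr_ge0; [exact: le_trans (vC n)|exact: ltW].
have lohi n k : b (-1) n <= b 1 k.
  apply: le_trans (lo _ _ (leq_maxl n k)) _.
  apply: le_trans (hi _ _ (leq_maxr n k)).
  by rewrite /b; have Kmax := K0 (maxn n k); lra.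
exists (sup (range (b (-1)))) => n.
have le_sup : b (-1) n <= sup (range (b (-1))).
  apply: ub_le_sup; last by exists n.
  by exists (b 1 0%N) => _ [k _ <-].
have sup_le : sup (range (b (-1))) <= b 1 n.
  apply: ge_sup; first by exists (b (-1) 0%N), 0%N.
  by move=> _ [k _ <-].
rewrite ler_norml; apply/andP; move: le_sup sup_le; rewrite /b -/K => sup_lo sup_hi; lra.
Qed.

(** The index of the dyadic interval of length [2 ^ (-n)] containing [x]; through it the data of
    step [n] become a step function on the line. *)
Definition dyadic_floor (n : nat) (x : R) : int := Num.floor (2 ^+ n * x).

Lemma dyadic_floorP n x :
  (dyadic_floor n x)%:~R / 2 ^+ n <= x < (dyadic_floor n x)%:~R / 2 ^+ n + (2 ^+ n)^-1.
Proof.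
have p2 : 0 < 2 ^+ n :> R by rewrite exprn_gt0.
rewrite -[X in _ < _ + X]mul1r -mulrDl ler_pdivrMr// ltr_pdivlMr// -intrD1.
by rewrite ![x * _]mulrC floor_itv.
Qed.

Lemma dyadic_floorK n (j : int) : dyadic_floor n ((2 ^+ n)^-1 * j%:~R) = j.
Proof. by rewrite /dyadic_floor mulVKf ?expf_neq0// intrKfloor. Qed.

Lemma dyadic_floorS n x : exists2 e : nat, (e <= 1)%N &
  dyadic_floor n.+1 x = 2 * dyadic_floor n x + e%:Z.
Proof.
have := floor_itv (2 ^+ n * x); have := floor_itv (2 ^+ n.+1 * x).
rewrite -!/(dyadic_floor _ _); set a := dyadic_floor _ _.
set b := dyadic_floor _ _; rewrite exprS -mulrA => /andP[a1 a2] /andP[b1 b2].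
have ab1 : 2 * b <= a.
  suff : 2 * b < a + 1 by lia.
  by rewrite -(ltr_int R) intrM; lra.
have ab2 : a <= 2 * b + 1.
  suff : a < 2 * (b + 1) by lia.
  by rewrite -(ltr_int R) intrM; lra.
by exists `|(a - 2 * b)%R|%N; lia.
Qed.

Lemma dyadic_floor_near n x y : `|x - y| <= (2 ^+ n)^-1 -> x <= y ->
  dyadic_floor n y = dyadic_floor n x \/ dyadic_floor n y = dyadic_floor n x + 1.
Proof.
move=> xy1 xy; have p2 : 0 < 2 ^+ n :> R by rewrite exprn_gt0.
have xyn : 2 ^+ n * y <= 2 ^+ n * x + 1.
  move: xy1; rewrite distrC ger0_norm ?subr_ge0// -[(_)^-1]mul1r.
  by rewrite ler_pdivlMr// mulrBl ![_ * 2 ^+ n]mulrC => ?; lra.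
have xyn' : 2 ^+ n * x <= 2 ^+ n * y by rewrite ler_pM2l.
have := floor_itv (2 ^+ n * x); have := floor_itv (2 ^+ n * y).
rewrite -!/(dyadic_floor _ _); set a := dyadic_floor _ _.
set b := dyadic_floor _ _; move=> /andP[a1 a2] /andP[b1 b2].
have ab1 : b < a + 1 by rewrite -(ltr_int R); lra.
have ab2 : a < b + 1 + 1 by rewrite -(ltr_int R) (intrD _ (b + 1)); lra.
lia.
Qed.

Lemma pow_arbitrarily_small (r K e : R) : 0 <= r -> r < 1 -> 0 < e ->
  exists n, K * r ^+ n <= e.
Proof.
move=> r0 r1 e0; have r1' : `|r| < 1 by rewrite ger0_norm.
have := cvg_geometric K r1' => /cvgrPdist_le/(_ e e0)[n _ /(_ n (leqnn n))] /=.
rewrite sub0r normrN => Kn; exists n; exact: le_trans (ler_norm _) Kn.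
Qed.

Definition dyadic_limit (r : R) u f : Prop :=
  exists C : R, forall n x, `|u n (dyadic_floor n x) - f x| <= C * r ^+ n.

Lemma dyadic_limitP r u f : dyadic_limit r u f ->
  exists C : R, forall n j, `|u n j - f ((2 ^+ n)^-1 * j%:~R)| <= C * r ^+ n.
Proof. by case=> C uC; exists C => n j; rewrite -{1}(dyadic_floorK n j). Qed.

(** Along the binary digits of a fixed [x] the values have geometrically small increments. *)
Lemma refinement_limit u (C r : R) : r < 1 ->
  (forall n (j : int) (e : nat), (e <= 1)%N ->
     `|u n.+1 (2 * j + e%:Z) - u n j| <= C * r ^+ n) ->
  exists f, dyadic_limit r u f.
Proof.
move=> r1 uS.
have /choice[f fP] x : exists l : R, forall n,
    `|u n (dyadic_floor n x) - l| <= C / (1 - r) * r ^+ n.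
  by apply: geometric_limit => // n; have [e e1 ->] := dyadic_floorS n x; exact: uS.
by exists f, (C / (1 - r)) => n x.
Qed.

(** The approximating step functions jump, but only by [O(r ^ n)], and points within [2 ^ (-n)] lie
    in the same or in adjacent dyadic intervals. *)
Lemma dyadic_limit_continuous u f (C r : R) : 0 <= r -> r < 1 ->
  dyadic_limit r u f -> (forall n j, `|fdiff (u n) j| <= C * r ^+ n) ->
  continuous f.
Proof.
move=> r0 r1 [D uf] uC x; apply/cvgrPdist_le => e e0.
have [n ne] := pow_arbitrarily_small (D + D + C) r0 r1 e0.
have p2 : 0 < (2 ^+ n)^-1 :> R by rewrite invr_gt0 exprn_gt0.
have C0 : 0 <= C * r ^+ n by exact: le_trans (uC n 0).
have main a b : a <= b -> `|a - b| <= (2 ^+ n)^-1 -> `|f b - f a| <= e.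
  move=> ab abn; apply: le_trans ne.
  have -> : f b - f a = (u n (dyadic_floor n a) - f a) -
     (u n (dyadic_floor n b) - f b) +
     (u n (dyadic_floor n b) - u n (dyadic_floor n a)) by ring.
  rewrite !mulrDl; apply: le_trans (ler_normD _ _) _; apply: lerD.
    by apply: le_trans (ler_normB _ _) _; apply: lerD.
  have [->|->] := dyadic_floor_near abn ab; first by rewrite subrr normr0.
  exact: uC.
near=> y; have xy : `|x - y| <= (2 ^+ n)^-1.
  by near: y; apply/nbhs_ballP; exists (2 ^+ n)^-1 => // y /ltW.
have [xley|/ltW ylex] := leP x y; first by rewrite distrC; exact: main.
by apply: main => //; rewrite distrC.
Unshelve. all: by end_near. Qed.

Lemma fdiff_sum_bound (v : int -> R) (kappa eta : R) (a b : int) : a <= b ->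
  (forall j, a <= j < b -> `|fdiff v j - kappa| <= eta) ->
  `|v b - v a - (b - a)%:~R * kappa| <= (b - a)%:~R * eta.
Proof.
move=> ab vab; pose n := `|(b - a)%R|%N.
have bE : b = a + n%:Z by rewrite /n; lia.
have -> : (b - a)%:~R = n%:R :> R by rewrite bE addrAC subrr add0r.
rewrite bE; have : (n <= n)%N by [].
elim: {1 3 4 5}n => [|k IH] kn; first by rewrite addr0 subrr !mul0r subr0 normr0.
have -> : a + k.+1%:Z = a + k%:Z + 1 by lia.
rewrite -[k.+1]addn1 natrD !mulrDl !mul1r.
have -> : v (a + k%:Z + 1) - v a - (k%:R * kappa + kappa) =
   v (a + k%:Z) - v a - k%:R * kappa + (fdiff v (a + k%:Z) - kappa).
  by rewrite /fdiff; ring.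
apply: le_trans (ler_normD _ _) _; apply: lerD; first by apply: IH; exact: ltnW.
by apply: vab; lia.
Qed.

(** The increment of [f] is replaced by that of [u n], a sum of differences close to [2 ^ (-n) g x].
    The radius [del] is fixed before [y] and [y'], the step [n] after them, which makes all errors
    of order [r ^ n] small against [y' - y]. *)
Lemma dyadic_limit_derive u z f g (C r : R) : 2^-1 <= r -> r < 1 ->
  dyadic_limit r u f -> dyadic_limit r z g -> continuous g ->
  (forall n j, `|2 ^+ n * fdiff (u n) j - z n j| <= C * r ^+ n) ->
  forall x : R, is_derive x (1 : R) f (g x).
Proof.
move=> r_half r1 [C1 uf] /dyadic_limitP[C2 zg] gcont uz x.
have r0 : 0 <= r by lra.
have two_r n : (2 ^+ n)^-1 <= r ^+ n.
  by rewrite -exprVn; apply: lerXn2r => //; rewrite nnegrE.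
have C10 : 0 <= C1 by have := uf 0%N 0; rewrite mulr1; exact: le_trans.
(* Two free points in place of [x] and [x + h] treat both signs of [h] at once. *)
have slope e : 0 < e -> exists2 del : R, 0 < del & forall y y',
    `|y - x| < del -> `|y' - x| < del -> y < y' ->
    `|f y' - f y - (y' - y) * g x| <= e * (y' - y).
  move=> e0; have e4 : 0 < e / 4 by lra.
  have /cvgrPdist_le/(_ _ e4)/nbhs_ballP[d /= d0 gd] := gcont x.
  exists (d / 2) => [|y y' yx y'x yy']; first by lra.
  pose L := y' - y; have L0 : 0 < L by rewrite subr_gt0.
  (* [K] collects the errors of order [r ^ n]: [C1] at each end, [|g x|] and [e / 2] from rounding
     the length. [T] dominates all constants, so that one [n] suffices. *)
  pose K := C1 + C1 + `|g x| + e / 2.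
  have K0 : 0 <= K by rewrite /K; have gx0 := normr_ge0 (g x); lra.
  pose T := 1 + K + `|C| + `|C2|.
  have eta0 : 0 < Num.min (d / 2) (Num.min (e / 4) (e / 2 * L)).
    by rewrite !lt_min; apply/and3P; split; [lra|lra|apply: mulr_gt0 => //; lra].
  have [n] := pow_arbitrarily_small T r0 r1 eta0.
  rewrite !le_min => /and3P[nd ne nL].
  have rn0 : 0 <= r ^+ n by rewrite exprn_ge0.
  have dom (X : R) : X <= T -> X * r ^+ n <= T * r ^+ n by move=> XT; rewrite ler_wpM2r.
  have := dom 1; have := dom (C + C2); have := dom K; rewrite mul1r.
  have := ler_norm C; have := ler_norm C2.
  move=> C2n Cn domK domC dom1.
  have rnd : r ^+ n <= d / 2.
    apply: (le_trans _ nd); apply: dom1; rewrite /T.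
    by have nC := normr_ge0 C; have nC2 := normr_ge0 C2; lra.
  have Cnd : (C + C2) * r ^+ n <= e / 4.
    by apply: (le_trans _ ne); apply: domC; rewrite /T; lra.
  have KnL : K * r ^+ n <= e / 2 * L.
    apply: (le_trans _ nL); apply: domK; rewrite /T.
    by have nC := normr_ge0 C; have nC2 := normr_ge0 C2; lra.
  pose h : R := (2 ^+ n)^-1; have hr : h <= r ^+ n := two_r n.
  have h0 : 0 < h by rewrite invr_gt0 exprn_gt0.
  pose a := dyadic_floor n y; pose b := dyadic_floor n y'.
  have /andP[ay ya] := dyadic_floorP n y; have /andP[by' y'b] := dyadic_floorP n y'.
  rewrite -/a -/h in ay ya; rewrite -/b -/h in by' y'b.
  have ab : a <= b by rewrite /a /b /dyadic_floor le_floor// ler_wpM2l ?exprn_ge0// ltW.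
  (* Such dyadic points lie within [d] of [x]: the points [y] and [y'] are closer than [d / 2], and
     rounding costs at most [h <= d / 2]. *)
  have near_gx j : a <= j < b -> `|fdiff (u n) j - h * g x| <= h * (e / 2).
    move=> /andP[aj jb].
    have aj' : a%:~R * h <= j%:~R * h by rewrite ler_wpM2r ?(ltW h0)// ler_int.
    have jb' : j%:~R * h <= b%:~R * h by rewrite ler_wpM2r ?(ltW h0)// ler_int ltW.
    have -> : fdiff (u n) j = h * (2 ^+ n * fdiff (u n) j).
      by rewrite mulKf// expf_neq0.
    rewrite -mulrBr normrM ger0_norm ?(ltW h0)// ler_wpM2l ?(ltW h0)//.
    have gj : `|g x - g (h * j%:~R)| <= e / 4.
      apply: gd; rewrite /ball /= ltr_norml.
      move: yx y'x; rewrite !ltr_norml => /andP[yx1 yx2] /andP[y'x1 y'x2].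
      by apply/andP; split; lra.
    have := uz n j; have := zg n j; rewrite -/h => zgj uzj.
    have -> : 2 ^+ n * fdiff (u n) j - g x = (2 ^+ n * fdiff (u n) j - z n j) +
      (z n j - g (h * j%:~R)) - (g x - g (h * j%:~R)) by ring.
    apply: le_trans (ler_normB _ _) _.
    by have := ler_normD (2 ^+ n * fdiff (u n) j - z n j) (z n j - g (h * j%:~R)); lra.
  have sum := fdiff_sum_bound ab near_gx.
  rewrite !mulrA intrB in sum; set t := (b%:~R - a%:~R) * h in sum.
  (* Both ends are rounded down, so the two lengths differ by at most one step. *)
  have tL : `|t - L| <= h by rewrite /t /L ler_norml; apply/andP; split; lra.
  have -> : f y' - f y - L * g x = (u n b - u n a - t * g x) +
     ((t - L) * g x - (u n b - f y') + (u n a - f y)) by ring.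
  have uy := uf n y; have uy' := uf n y'; rewrite -/a in uy; rewrite -/b in uy'.
  have tg : `|(t - L) * g x| <= r ^+ n * `|g x|.
    by rewrite normrM ler_wpM2r// (le_trans tL).
  have te : t * (e / 2) <= (L + r ^+ n) * (e / 2).
    rewrite ler_wpM2r//; first by lra.
    by move: tL; rewrite ler_norml => /andP[tL1 tL2]; lra.
  have n1 := ler_normD (u n b - u n a - t * g x) ((t - L) * g x - (u n b - f y') + (u n a - f y)).
  have n2 := ler_normD ((t - L) * g x - (u n b - f y')) (u n a - f y).
  have n3 := ler_normB ((t - L) * g x) (u n b - f y').
  rewrite -/L; apply: (@le_trans _ _ (K * r ^+ n + e / 2 * L)); last by lra.
  rewrite -mulrA in sum; rewrite /K; clear -sum uy uy' tg te n1 n2 n3; lra.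
have slope0 e : 0 < e -> exists2 del : R, 0 < del & forall h,
    h != 0 -> `|h| < del -> `|f (h + x) - f x - h * g x| <= e * `|h|.
  move=> e0; have [del del0 fdel] := slope e e0; exists del => // h.
  have xx : `|x - x| < del by rewrite subrr normr0.
  have hx : h + x - x = h by rewrite addrK.
  rewrite neq_lt => /orP[] h0 hdel.
    have hx_lt : h + x < x by lra.
    have := fdel (h + x) x; rewrite hx => /(_ hdel xx hx_lt).
    have -> : x - (h + x) = - h by ring.
    rewrite (ltr0_norm h0) -[`|f (h + x) - _ - _|]normrN.
    suff -> : f x - f (h + x) - - h * g x = - (f (h + x) - f x - h * g x) by [].
    by ring.
  have hx_lt : x < h + x by lra.
  have := fdel x (h + x); rewrite hx => /(_ xx hdel hx_lt).
  by rewrite (gtr0_norm h0).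
have quot : h^-1 *: ((f \o shift x) (h *: (1 : R)) - f x) @[h --> 0^'] --> g x.
  apply/cvgrPdist_le => e e0; have [del del0 fdel] := slope0 e e0.
  near=> h; have h_neq0 : h != 0 by near: h; exact: nbhs_dnbhs_neq.
  have h_small : `|h| < del by near: h; exact: dnbhs0_lt.
  have -> : g x - h^-1 *: ((f \o shift x) (h *: (1 : R)) - f x) =
      - h^-1 * (f (h + x) - f x - h * g x).
    by rewrite /GRing.scale /= mulr1; field.
  rewrite normrM normrN normfV mulrC ler_pdivrMr ?normr_gt0//; exact: fdel.
apply: DeriveDef; last exact: cvg_lim.
by apply/cvg_ex; exists (g x).
Unshelve. all: by end_near.
Qed.

End Limit.

(** * Convergence of Hermite schemes *)

Section Convergence.
Context {R : realType}.
Implicit Types (A B : int -> 'M[R]_2) (f : R -> R).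

Lemma dilE n (v : 'cV[R]_2) :
  dil ^+ n *m v = vec2 (v 0 0) ((2 ^+ n)^-1 * v 1 0).
Proof.
elim: n v => [|n IH] v.
  by rewrite expr0 mul1mx; apply: eq_vec2; rewrite !mxE //= invr1 mul1r.
rewrite exprSr -mulmxE -mulmxA IH mul_diag_mx.
by apply: eq_vec2; rewrite !mxE /= ?mul1r// exprSr invfM mulrA.
Qed.

Lemma seq_bounded_norm (c : int -> 'cV[R]_2) : seq_bounded c ->
  exists x : R, forall j, `|c j| <= x.
Proof.
rewrite /seq_bounded; have := norm_le_seq_norm c.
case: (seq_norm c) => [x| |] // cx _; last by have := cx 0.
by exists x.
Qed.

Lemma limit_on_rate (c : nat -> int -> 'cV[R]_2) (K : set R) f (C r : R) :
  0 <= r -> r < 1 ->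
  (forall n j, `|c n j - hermite_fun f ((2 ^+ n)^-1 * j%:~R)| <= C * r ^+ n) ->
  limit_on c K f.
Proof.
move=> r0 r1 cC; have r1' : `|r| < 1 by rewrite ger0_norm.
apply: squeeze_cvgr (cvg_cst 0) (cvg_geometric C r1').
near=> n; set E := [set _ | _ in _].
have E_le y : E y -> 0 <= y <= C * r ^+ n.
  by move=> [j _ <-]; rewrite normr_ge0 cC.
have C0 : 0 <= C * r ^+ n by exact: le_trans (cC n 0).
(* The supremum of the empty set is 0 by convention. *)
have [->|/set0P[y Ey]] := eqVneq E set0; first by rewrite sup0 lexx.
apply/andP; split; last first.
  by apply: ge_sup => [|z /E_le/andP[]//]; exists y.
apply: le_trans (_ : y <= _); first by have /andP[] := E_le _ Ey.
apply: ub_le_sup => //; exists (C * r ^+ n) => z /E_le/andP[]//.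
Unshelve. all: by end_near. Qed.

Lemma derive1n_chain (F : nat -> R -> R) d :
  (forall m, (m < d)%N -> forall x : R, is_derive x (1 : R) (F m) (F m.+1 x)) ->
  forall m, (m <= d)%N -> derive1n m (F 0%N) = F m.
Proof.
move=> dF; elim=> [//|m IH] md; rewrite derive1nS IH; last exact: ltnW.
by apply/funext => x; rewrite derive1E; have := dF _ md x => ?; exact: derive_val.
Qed.

Lemma class_C_chain (F : nat -> R -> R) d : continuous (F d) ->
  (forall m, (m < d)%N -> forall x : R, is_derive x (1 : R) (F m) (F m.+1 x)) ->
  class_C d (F 0%N).
Proof.
move=> Fd dF; split; last by rewrite (derive1n_chain dF).
move=> m x md; rewrite (derive1n_chain dF) ?(ltnW md)//.
by have := dF _ md x => ?; exact: ex_derive.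
Qed.

Lemma gregory_coef0 : gregory_coef 0 = 1 :> R.
Proof.
by rewrite /gregory_coef big_ord1 /= invr1 !mul1r.
Qed.

(** The scaled levels [w m] converge to functions [F m], each the derivative of the preceding one.
    Since [s n] is [c n] with its second component scaled by [2 ^ (-n)], the components of [c n] are
    [w 0] and [w 1]. *)
Lemma hermite_limit A B d (p : nat -> {poly R}) (c : nat -> int -> 'cV[R]_2) :
  (1 <= d)%N -> finite_mask A -> finite_mask B ->
  spectral_polys A d p ->
  (forall k, (k <= d)%N -> forall j, defect d (poly_seq (p k)) j = 0) ->
  (forall c j, gregory_op d (subdiv A c) j =
     (2 ^+ d)^-1 *: subdiv B (gregory_op d c) j) ->
  contractive (subdiv B) ->
  hermite_scheme A c -> seq_bounded (c 0%N) ->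
  exists f, class_C d f /\ forall K, limit_on c K f.
Proof.
move=> d1 Af Bf pP p0 AB Bc cA /seq_bounded_norm[x cx].
pose s n j := dil ^+ n *m c n j.
have sS n : s n.+1 = subdiv A (s n) by apply/funext => j; exact: cA.
have s0 j : `|s 0%N j| <= x by rewrite /s expr0 mul1mx.
have [r [r_half r1 decay]] := level_decay Af Bf pP p0 AB Bc sS s0.
have r0 : 0 <= r by lra.
have p2 k : 0 < 2 ^+ k :> R by rewrite exprn_gt0.
pose w m n j := 2 ^+ (m * n) * level m (s n) j.
have w_scale m n (y C : R) : `|y| <= C * r ^+ n / 2 ^+ (m * n) ->
    `|2 ^+ (m * n) * y| <= C * r ^+ n.
  by rewrite ler_pdivlMr// normrM (ger0_norm (ltW (p2 _))) mulrC.
have w_diff m : (m <= d)%N ->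
    exists C : R, forall n j, `|fdiff (w m n) j| <= C * r ^+ n.
  move=> md; have [C HC] := decay m md; exists C => n j; have [lC dC] := HC n j.
  rewrite /fdiff /w -mulrBr -/(fdiff (level m (s n)) j); apply: w_scale.
  (* The difference of level [m] is the next level for [m > 0] and the defect of order 0 for
     [m = 0]. *)
  by case: m md {HC} lC dC => [|m] md; rewrite // /defect big_ord0 subr0.
(* The condition [m <= d] stands under the existential so that choice yields a family over all [m];
   beyond [d] its members are arbitrary. *)
have w_limit m : exists f, (m <= d)%N -> dyadic_limit r (w m) f.
  have [md|dm] := leqP m d; last by exists (cst 0).
  have [C HC] := decay m md.
  have [K K0 AK] := level_refinement Af pP p0 md.
  have wS n (j : int) (e : nat) : (e <= 1)%N ->
      `|w m n.+1 (2 * j + e%:Z) - w m n j| <= 2 ^+ m * (K * C) * r ^+ n.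
    move=> e1; rewrite -mulrA /w sS; apply: rescale_refinement.
    have := AK (s n) _ (fun j => (HC n j).1) (fun j => (HC n j).2) j e e1.
    by rewrite !mulrA.
  by have [f wf] := refinement_limit r1 wS; exists f.
have /choice[F FP] := w_limit.
have F_cont m : (m <= d)%N -> continuous (F m).
  by move=> md; have [C wC] := w_diff m md; exact: dyadic_limit_continuous (FP _ md) wC.
have F_deriv m : (m < d)%N ->
    forall x : R, is_derive x (1 : R) (F m) (F m.+1 x).
  move=> md; have [C slope] : exists C : R, forall n j,
      `|2 ^+ n * fdiff (w m n) j - w m.+1 n j| <= C * r ^+ n.
    (* For [m = 0] the difference quotient and the next level differ by the scaled defect of order
       1, as [G_0 = 1]; for [m > 0] they coincide. *)
    case: m md => [|m] md.
      have [C HC] := decay 1%N d1; exists C => n j; have [_] := HC n j.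
      rewrite /defect big_ord1 gregory_coef0 mul1r => /w_scale.
      by rewrite mul1n /w mul0n expr0 mul1n /fdiff !mul1r mulrBr.
    exists 0 => n j; rewrite mul0r.
    have -> : 2 ^+ n * fdiff (w m.+1 n) j = w m.+2 n j.
      by rewrite /w [(m.+2 * n)%N]mulSn exprD /= /fdiff; ring.
    by rewrite subrr normr0.
  exact: dyadic_limit_derive r_half r1 (FP _ (ltnW md)) (FP _ md) (F_cont _ md) slope.
exists (F 0%N); split; first exact: class_C_chain (F_cont _ (leqnn d)) F_deriv.
move=> K.
have [C0 w0] := dyadic_limitP (FP 0%N (leq0n d)).
have [C1 w1] := dyadic_limitP (FP 1%N d1).
have C00 : 0 <= C0 by have := w0 0%N 0; rewrite expr0 mulr1; exact: le_trans.
have C10 : 0 <= C1 by have := w1 0%N 0; rewrite expr0 mulr1; exact: le_trans.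
apply: (@limit_on_rate c K (F 0%N) (C0 + C1) r r0 r1) => n j.
have rn0 : 0 <= r ^+ n by rewrite exprn_ge0.
apply: vec_norm_le; first by rewrite mulr_ge0// addr_ge0.
rewrite mulrDl; elim/ord2P; rewrite !mxE /=.
  have -> : c n j 0 0 = w 0%N n j by rewrite /w mul0n mul1r /= /s dilE vec2E0.
  by apply: le_trans (w0 n j) _; rewrite lerDl mulr_ge0.
have -> : c n j 1 0 = w 1%N n j by rewrite /w mul1n /= /s dilE vec2E1 mulVKf// gt_eqF.
have -> : derive1 (F 0%N) = F 1%N by exact: (derive1n_chain F_deriv d1).
by apply: le_trans (w1 n j) _; rewrite lerDr mulr_ge0.
Qed.

End Convergence.

Theorem corollary2 (R : realType) (d : nat) (A B : int -> 'M[R]_2)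
  (d_ge1 : (1 <= d)%N)
  (A_fin : finite_mask A)
  (A_spec : spectral_condition A d)
  (B_fin : finite_mask B)
  (AB : forall (c : int -> 'cV[R]_2) (j : int),
     gregory_op d (subdiv A c) j
     = (2 ^+ d)^-1 *: subdiv B (gregory_op d c) j)
  (B_contr : contractive (subdiv B)) :
  hermite_convergent A d.
Proof.
have p_ann := gregory_annihilates A_fin B_fin A_spec AB B_contr.
case: A_spec => p pP; split.
  move=> c cA c0 K _.
  have p0 k : (k <= d)%N -> forall j, defect d (poly_seq (p k)) j = 0.
    by move=> kd; apply: p_ann; have [szp _ _] := pP _ kd; exact: leq_trans szp _.
  have [f [f_C f_lim]] :=
    hermite_limit d_ge1 A_fin B_fin pP p0 AB B_contr cA c0.
  by exists f.
(* Nontriviality: the spectral condition forces [p 0 = 1], so the constant data (1, 0) are invariant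
   and have the limit function 1. *)
pose c (n : nat) (j : int) : 'cV[R]_2 := vec2 1 0.
have cE : c 0%N = poly_seq 1.
  by apply/funext => j; apply: eq_vec2; rewrite !mxE /= ?hornerC ?derivC ?horner0.
have dilc n j : dil ^+ n *m c n j = vec2 1 0.
  by rewrite dilE vec2E0 vec2E1 mulr0.
have [szp p0 Ap] := pP 0%N (leq0n d).
have p1 : p 0%N = 1.
  by move/size1_polyC: szp => ->; rewrite p0 invr1.
exists c; split.
- move=> n j; rewrite dilc; under eq_fun do rewrite dilc.
  by have := Ap j; rewrite p1 -cE expr0 invr1 scale1r.
- apply: le_lt_trans (seq_norm_le (x := `|vec2 1 0 : 'cV[R]_2|) _) (ltry _).
  by move=> j.
pose F (m : nat) : R -> R := cst (if m is 0%N then 1 else 0).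
exists (F 0%N); split.
- by apply: (@class_C_chain _ F); exact: cst_continuous.
- move=> K _; apply: (@limit_on_rate _ _ _ _ 0 0) => // n j.
  rewrite mul0r /hermite_fun derive1_cst subrr normr0 //.
- by exists 0; rewrite oner_neq0.
Qed.
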